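(* Let $X\subset\mathbb{R}^N$ be a set of points that determines an $N$-dimensional polytope $P$. Let $E$ be the number of edges of $P$ and let $\sigma$ be the sum of the squares of the lengths of the edges of $P$. Let $S$ be an $M$-dimensional linear subspace of $\mathbb{R}^N$, and let $\sigma'$ be the sum, over all edges of $P$, of the squares of the lengths of their orthogonal projections onto $S$. Let $G$ be the group of proper symmetries of $P$. If $G$ acts transitively on the set of edges of $P$, then $$\sigma'=\sigma\cdot\frac{M}{N}.$$
   Context: $\mathbb{R}^N$ carries its standard Euclidean inner product and norm. The polytope $P$ determined by $X$ is the convex hull of the finite set $X$; it is $N$-dimensional, i.e. not contained in any proper affine subspace of $\mathbb{R}^N$. The edges of $P$ are its one-dimensional faces, regarded as unoriented segments. For an edge with endpoints $x,y$, its length is $\|x-y\|$ and the length of its projection onto $S$ is $\|P_S(x-y)\|$, where $P_S:\mathbb{R}^N\to S$ is the orthogonal projection. A proper symmetry of $P$ is an orientation-preserving isometry of $\mathbb{R}^N$ mapping $P$ onto itself (reflections and other orientation-reversing isometries are excluded); such symmetries permute the edges of $P$. Transitivity means that for any two edges of $P$ some element of $G$ maps the first onto the second. *)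

(* Defs.v *)
From HB Require Import structures.
From mathcomp Require Import all_boot all_order all_algebra.
From mathcomp Require Import boolp classical_sets cardinality fsbigop.
From mathcomp Require Import reals convex.

Set Implicit Arguments.
Unset Strict Implicit.
Unset Printing Implicit Defensive.

Import Order.TTheory GRing.Theory Num.Theory.
Local Open Scope classical_set_scope.
Local Open Scope ring_scope.

Section Euclidean.
Variables (R : realType) (N : nat).
Local Notation V := 'rV[R]_N.

Definition dot (u v : V) : R := \sum_(i < N) u 0 i * v 0 i.

(* The norm that the analysis library puts on 'rV[R]_N is the sup norm, hence
   a separate Euclidean one. *)
Definition enorm (u : V) : R := Num.sqrt (dot u u).

Definition orth_proj (S : {vspace V}) (x : V) : V :=
  xget 0 [set p | p \in S /\ forall s, s \in S -> dot (x - p) s = 0].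

Definition affine_subspace (a : V) (U : {vspace V}) : set V :=
  [set x | x - a \in U].

(* [d] is the least dimension of an affine subspace containing [A]; the empty
   set has no dimension. In particular [affine_dim A N] says that the nonempty
   set [A] lies in no proper affine subspace. *)
Definition affine_dim (A : set V) (d : nat) : Prop :=
  [/\ A !=set0,
      exists a U, \dim U = d /\ A `<=` affine_subspace a U &
      forall a U, A `<=` affine_subspace a U -> (d <= \dim U)%N].

Definition convex_hull (A : set V) : set V := smallest (@convex_set R V) A.

(* The case [c = 0] makes [P] a face of itself; when [N = 1] this is the only
   edge. The empty face is missing unless [P] is empty. *)
Definition face (P F : set V) : Prop :=
  exists c : V, F = [set x | P x /\ forall y, P y -> dot c y <= dot c x].

Definition edges (P : set V) : set (set V) :=
  [set F | face P F /\ affine_dim F 1].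

(* The two endpoints of a segment, in an arbitrary order. *)
Definition endpoints (F : set V) : V * V :=
  xget (0, 0) [set p | F = convex_hull [set p.1; p.2]].

Definition edge_length (F : set V) : R :=
  enorm ((endpoints F).1 - (endpoints F).2).

Definition proj_edge_length (S : {vspace V}) (F : set V) : R :=
  enorm (orth_proj S ((endpoints F).1 - (endpoints F).2)).

(* A polytope has finitely many edges, so neither of the following sums takes
   the default value 0 of [\sum_(_ \in _)] at infinite supports. *)
Definition sum_sq_edges (P : set V) : R :=
  \sum_(F \in edges P) edge_length F ^+ 2.

Definition sum_sq_proj_edges (S : {vspace V}) (P : set V) : R :=
  \sum_(F \in edges P) proj_edge_length S F ^+ 2.

Definition isometry (g : V -> V) : Prop :=
  forall x y, enorm (g x - g y) = enorm (x - y).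

(* The i-th row is g(e_i) - g(0): for [g] affine this is the matrix of its
   linear part, acting on row vectors from the right. *)
Definition linear_part (g : V -> V) : 'M[R]_N :=
  \matrix_(i < N) (g (delta_mx 0 i) - g 0).

Definition orientation_preserving (g : V -> V) : Prop :=
  0 < \det (linear_part g).

(* The underlying set of the group G; the group law is composition. *)
Definition proper_symmetries (P : set V) : set (V -> V) :=
  [set g | [/\ isometry g, orientation_preserving g & g @` P = P]].

Definition transitive_on_edges (G : set (V -> V)) (P : set V) : Prop :=
  forall F F', edges P F -> edges P F' -> exists2 g, G g & g @` F = F'.

End Euclidean.

(* Main.v *)
Require Import Defs.
From HB Require Import structures.
From mathcomp Require Import all_boot all_order all_algebra.
From mathcomp Require Import boolp classical_sets cardinality fsbigop.
From mathcomp Require Import reals convex.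
From mathcomp Require Import functions interval_inference ring lra.

Import Order.TTheory GRing.Theory Num.Theory.
Local Open Scope classical_set_scope.
Local Open Scope ring_scope.

Set Implicit Arguments.
Unset Strict Implicit.
Unset Printing Implicit Defensive.

(** Let [T = edge_tensor P] be the sum, over the edges of the polytope [P], of
the matrices [d^T d], where [d] is the difference of the two endpoints. Its trace is the sum of the squared edge
lengths, and [\tr (T *m Q)], with [Q] the matrix of the orthogonal projection
onto [S], is that of the projected edges. As [\tr Q = M], it suffices that [T]
is a scalar matrix.

The symmetries fix the centroid [z] of the midpoints of the edges, and their
linear parts commute with [T]. Let [x, y] be the endpoints of an edge. By
transitivity all the edges at [x] have the same inner products with [x - z] and
with [(x - z) *m T], so a combination of these two vectors is orthogonal to all
the edges at [x]. The edges at a vertex span the space ([edges_span], by the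
argument that makes the simplex method correct), hence [x - z] is an eigenvector
of [T] ([endpoint_eigenvector]); so is [y - z]. If the eigenvalues agree, then,
since each neighbour of [x] is an image of [x] or of [y], all the edges at [x]
are eigenvectors for this eigenvalue, and [T] is scalar ([scalar_tensor]).

Otherwise the orbits of [x] and of [y] lie in two orthogonal eigenspaces. Each
edge joins the two orbits, and it follows that each orbit lies on a line through
[z]: the polytope is a rhombus with centre [z], where the two edges at [x] are
exchanged only by a reflection. Proper symmetries are then not transitive on the
edges ([no_orthogonal_orbits]). *)

(** * Inner product *)

Section Dot.
Variables (R : realType) (N : nat).
Implicit Types (u v w : 'rV[R]_N) (a : R).

Lemma dotE u v : dot u v = (u *m v^T) 0 0.
Proof. by rewrite mxE; apply: eq_bigr => i _; rewrite mxE. Qed.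

Lemma dotC u v : dot u v = dot v u.
Proof. by apply: eq_bigr => i _; rewrite mulrC. Qed.

Lemma dotDl u v w : dot (u + v) w = dot u w + dot v w.
Proof. by rewrite !dotE mulmxDl mxE. Qed.

Lemma dotDr u v w : dot w (u + v) = dot w u + dot w v.
Proof. by rewrite dotC dotDl !(dotC w). Qed.

Lemma dotZl a u v : dot (a *: u) v = a * dot u v.
Proof. by rewrite !dotE -scalemxAl mxE. Qed.

Lemma dotZr a u v : dot u (a *: v) = a * dot u v.
Proof. by rewrite dotC dotZl dotC. Qed.

Lemma dotNl u v : dot (- u) v = - dot u v.
Proof. by rewrite -scaleN1r dotZl mulN1r. Qed.

Lemma dotNr u v : dot u (- v) = - dot u v.
Proof. by rewrite dotC dotNl dotC. Qed.

Lemma dot0l v : dot 0 v = 0.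
Proof. by rewrite -(scale0r 0) dotZl mul0r. Qed.

Lemma dot0r v : dot v 0 = 0.
Proof. by rewrite dotC dot0l. Qed.

Definition dot_lin := (dotDl, dotDr, dotNl, dotNr, dotZl, dotZr).

Lemma dot_ge0 u : 0 <= dot u u.
Proof. by apply: sumr_ge0 => i _; rewrite -expr2 sqr_ge0. Qed.

Lemma dot_eq0 u : (dot u u == 0) = (u == 0).
Proof.
apply/eqP/eqP => [u0|->]; last by rewrite dot0l.
apply/rowP => i; rewrite mxE; apply/eqP; rewrite -sqrf_eq0 expr2.
apply/eqP; move: i isT; apply: psumr_eq0P => // i _.
by rewrite -expr2 sqr_ge0.
Qed.

Lemma dot_gt0 u : u != 0 -> 0 < dot u u.
Proof. by move=> u0; rewrite lt0r dot_eq0 u0 dot_ge0. Qed.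

Lemma dot_mulmx u v (A : 'M[R]_N) : dot (u *m A) v = dot u (v *m A^T).
Proof. by rewrite !dotE trmx_mul trmxK mulmxA. Qed.

Lemma enorm_sqr u : enorm u ^+ 2 = dot u u.
Proof. by rewrite sqr_sqrtr ?dot_ge0. Qed.

End Dot.

(** * Convex hulls and segments *)

Section Convexity.
Variables (R : realType) (N : nat).
Local Notation V := 'rV[R]_N.
Implicit Types (A C X : set V) (c p q x y : V).

Lemma convex_setP A : convex_set A <->
  forall x y (t : R), 0 <= t <= 1 -> A x -> A y -> A (t *: x + (1 - t) *: y).
Proof.
split=> [cA x y t /andP[t0 t1] /mem_set Ax /mem_set Ay|cA x y t].
  have t01 : Itv.spec (@Itv.num_sem R) (Itv.Real `[0%Z, 1%Z]) t.
    by apply/andP; split; [exact: num_real|rewrite /= in_itv /= t0 t1].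
  exact: set_mem (cA x y (Itv.mk t01) Ax Ay).
move=> /set_mem Ax /set_mem Ay; apply/mem_set/cA => //.
by apply/andP; split.
Qed.

Lemma convex_convex_hull X : convex_set (convex_hull X : set V).
Proof.
apply/convex_setP => x y t t01 Hx Hy A [cA XA].
by move/convex_setP: (cA); apply => //; [apply: Hx|apply: Hy].
Qed.

Lemma sub_convex_hull X : X `<=` convex_hull X.
Proof. exact: sub_gen_smallest. Qed.

Lemma convex_hull_min X C :
  convex_set (C : set V) -> X `<=` C -> convex_hull X `<=` C.
Proof. exact: smallest_sub. Qed.

(** Minimality of the hull suffices: the points [p] of the half-space that lie
in [C] whenever they lie on the bounding hyperplane form a convex set, because
a proper combination lies on the hyperplane only if both of its ends do. *)
Lemma convex_hull_hyperplane X C c h : convex_set (C : set V) ->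
  (forall q, X q -> dot c q <= h) -> (forall q, X q -> dot c q = h -> C q) ->
  forall p, convex_hull X p -> dot c p <= h /\ (dot c p = h -> C p).
Proof.
move=> /convex_setP cC Xh XC; apply: (@convex_hull_min X
  [set p | dot c p <= h /\ (dot c p = h -> C p)]).
  apply/convex_setP => x y t t01 [xh Cx] [yh Cy]; rewrite /= !dot_lin.
  have [-> | t0] := eqVneq t 0.
    by rewrite subr0 !scale0r scale1r !add0r mul0r mul1r add0r.
  have [-> | t1] := eqVneq t 1.
    by rewrite subrr !scale0r scale1r !addr0 mul0r mul1r addr0.
  have [t0' t1'] := andP t01.
  have tp : 0 < t by rewrite lt_neqAle eq_sym t0.
  have tm : 0 < 1 - t by rewrite subr_gt0 lt_neqAle t1.
  have hx : t * dot c x <= t * h by rewrite ler_wpM2l.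
  have hy : (1 - t) * dot c y <= (1 - t) * h by rewrite ler_wpM2l // ltW.
  split; first lra.
  move=> e; apply: cC => //; [apply: Cx; apply: (mulfI (lt0r_neq0 tp))|
    apply: Cy; apply: (mulfI (lt0r_neq0 tm))]; lra.
by move=> q Xq; split; [apply: Xh|move=> ?; apply: XC].
Qed.

Lemma convex_hull_le X c h : (forall q, X q -> dot c q <= h) ->
  forall p, convex_hull X p -> dot c p <= h.
Proof.
move=> Xh p Pp; have [] // := @convex_hull_hyperplane X setT c h _ Xh _ p Pp.
Qed.

Lemma segmentP x y p : convex_hull [set x; y] p <->
  exists2 t : R, 0 <= t <= 1 & p = x + t *: (y - x).
Proof.
split=> [|[t /andP[t0 t1] ->]].
  move: p; apply: (@convex_hull_min _
    [set p | exists2 t : R, 0 <= t <= 1 & p = x + t *: (y - x)]).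
    apply/convex_setP => _ _ t /andP[? ?] [a /andP[? ?] ->] [b /andP[? ?] ->].
    exists (t * a + (1 - t) * b); first by apply/andP; split; nra.
    by apply/rowP => i; rewrite !mxE; ring.
  move=> _ [->|->] /=.
    by exists 0; rewrite ?lexx ?ler01// scale0r addr0.
  by exists 1; rewrite ?lexx ?ler01// scale1r addrC subrK.
have -> : x + t *: (y - x) = t *: y + (1 - t) *: x.
  by apply/rowP => i; rewrite !mxE; ring.
move/convex_setP: (@convex_convex_hull [set x; y]); apply; rewrite ?t0 //.
  by apply: sub_convex_hull; right.
by apply: sub_convex_hull; left.
Qed.

Lemma segmentC x y : convex_hull [set x; y] = convex_hull [set y; x].
Proof. by rewrite setUC. Qed.

Lemma segment_inj x y x' y' : convex_hull [set x; y] = convex_hull [set x'; y'] ->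
  (x = x' /\ y = y') \/ (x = y' /\ y = x').
Proof.
move=> e.
have in1 (a b : V) : convex_hull [set a; b] a by apply: sub_convex_hull; left.
have in2 (a b : V) : convex_hull [set a; b] b by apply: sub_convex_hull; right.
have /segmentP[s /andP[s0 s1] ex'] : convex_hull [set x; y] x' by rewrite e.
have /segmentP[t /andP[t0 t1] ey'] : convex_hull [set x; y] y' by rewrite e.
have /segmentP[s' /andP[s'0 s'1] ex] : convex_hull [set x'; y'] x by rewrite -e.
have /segmentP[t' /andP[t'0 t'1] ey] : convex_hull [set x'; y'] y by rewrite -e.
have [exy|nxy] := eqVneq x y.
  by left; rewrite ex' ey' exy subrr !scaler0 !addr0.
have d : y - x = ((t' - s') * (t - s)) *: (y - x).
  rewrite {1}ey {1}ex ey' ex'.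
  by apply/rowP => i; rewrite !mxE; ring.
have {d} d : (t' - s') * (t - s) = 1.
  move/eqP: d; rewrite -subr_eq0 -{1}(scale1r (y - x)) -scalerBl scaler_eq0.
  by rewrite (subr_eq0 y) (eq_sym y) (negPf nxy) orbF subr_eq0 => /eqP.
have [st|st] : t - s = 1 \/ t - s = -1.
    have [ts|ts] := lerP 0 (t - s); [left|right].
      have : 0 <= (t - s) * (1 - (t' - s')) by apply: mulr_ge0; lra.
      lra.
    have : 0 <= (s - t) * (1 + (t' - s')) by apply: mulr_ge0; lra.
    lra.
- left; have [s00 t11] : s = 0 /\ t = 1 by split; lra.
  by rewrite ex' ey' s00 t11 scale0r scale1r addr0 addrC subrK.
- right; have [s00 t11] : s = 1 /\ t = 0 by split; lra.
  by rewrite ex' ey' s00 t11 scale0r scale1r addr0 addrC subrK.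
Qed.

End Convexity.

(** * Perturbation of linear functionals *)

Section Perturbation.
Variables (R : realType) (N : nat).
Local Notation V := 'rV[R]_N.
Implicit Types (s : seq V) (u w z : V).

Lemma seq_argmax (T : eqType) (s : seq T) (f : T -> R) (x0 : T) : x0 \in s ->
  exists2 x, x \in s & forall y, y \in s -> f y <= f x.
Proof.
elim: s x0 => // a [|b s] IH x0 _.
  by exists a; rewrite ?mem_head // => y; rewrite inE => /eqP ->.
have [x xs xmax] := IH b (mem_head _ _).
have [le|lt] := lerP (f a) (f x).
  exists x; first by rewrite inE xs orbT.
  by move=> y; rewrite inE => /orP[/eqP ->|/xmax].
exists a; first exact: mem_head.
by move=> y; rewrite inE => /orP[/eqP ->//|/xmax /le_trans -> //]; rewrite ltW.
Qed.

Lemma small_perturbation s u w : exists2 e : R, 0 < e &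
  forall z, z \in s -> 0 < dot u z -> 0 < dot (u + e *: w) z.
Proof.
elim: s => [|a s [e e0 He]]; first by exists 1.
have [f f0 Hf] : exists2 f : R, 0 < f &
    0 < dot u a -> forall g : R, 0 < g <= f -> 0 < dot (u + g *: w) a.
  exists (`|dot u a| / (1 + `|dot w a|) + (dot u a == 0)%:R).
    have [->|ua] := eqVneq; first by rewrite normr0 mul0r add0r ltr01.
    by rewrite addr0 divr_gt0 ?normr_gt0 // ltr_wpDr.
  move=> ua g; rewrite gt_eqF // addr0 gtr0_norm // => /andP[g0].
  rewrite ler_pdivlMr ?ltr_wpDr // !dot_lin => gle.
  have : - (g * `|dot w a|) <= g * dot w a.
    by rewrite -mulrN ler_wpM2l ?(ltW g0) // lerNl -normrN ler_norm.
  lra.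
exists (Num.min e f); first by rewrite lt_min e0 f0.
move=> z; rewrite inE => /orP[/eqP -> ua|zs uz].
  by apply: Hf => //; rewrite lt_min e0 f0 ge_min lexx orbT.
have := He z zs uz; rewrite !dot_lin.
have : 0 < Num.min e f <= e by rewrite lt_min e0 f0 ge_min lexx.
move: (Num.min e f) => g /andP[g0 ge].
have [wz|wz] := lerP 0 (dot w z).
  by move=> _; rewrite ltr_pwDl // mulr_ge0 // ltW.
have : e * dot w z <= g * dot w z by rewrite ler_wnM2r // ltW.
lra.
Qed.

(** Adding a small multiple of [z] makes the functional positive at [z]; doing
this for one element of [s] after the other, with ever smaller multiples, never
destroys what has been achieved before. *)
Lemma generic_perturbation s u : exists u', forall z, z \in s -> z != 0 ->
  dot u' z != 0 /\ (0 < dot u z -> 0 < dot u' z).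
Proof.
suff [u' Hp Hn] : exists2 u', forall z, z \in s -> 0 < dot u z -> 0 < dot u' z
    & forall z, z \in s -> z != 0 -> dot u' z != 0.
  by exists u' => z zs z0; split; [apply: Hn|apply: Hp].
elim: {2}s => [|a r [u' Hp Hn]].
  by exists u.
have [e e0 He] := small_perturbation (s ++ r ++ [seq - z | z <- r]) u' a.
have [ua|ua] := eqVneq (dot u' a) 0; last first.
  exists u' => // z; rewrite inE => /orP[/eqP -> //|]; exact: Hn.
exists (u' + e *: a).
  by move=> z zs uz; apply: He; rewrite ?mem_cat ?zs //; apply: Hp.
move=> z; rewrite inE => /orP[/eqP -> a0|zr z0].
  by rewrite !dot_lin ua add0r mulf_neq0 ?gt_eqF ?dot_gt0.
have := Hn z zr z0; rewrite neq_lt => /orP[lt|gt].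
  rewrite -oppr_eq0 -dotNr gt_eqF // He ?dotNr ?oppr_gt0 //.
  by rewrite !mem_cat map_f ?orbT.
by rewrite gt_eqF // He // !mem_cat zr orbT.
Qed.

End Perturbation.

(** * Edges of a polytope *)

Section Edges.
Variables (R : realType) (N : nat).
Local Notation V := 'rV[R]_N.
Implicit Types (X P F : set V) (c u w x y p q : V).

Definition adjacent P x y := x <> y /\ edges P (convex_hull [set x; y]).

Definition exposed X x :=
  X x /\ exists c, forall q, X q -> q <> x -> dot c q < dot c x.

Lemma adjacentC P x y : adjacent P x y -> adjacent P y x.
Proof. by move=> [xy]; rewrite segmentC; split => // /esym. Qed.

Lemma affine_dim_segment x y : x <> y -> affine_dim (convex_hull [set x; y]) 1.
Proof.
move=> /eqP xy; have yx0 : y - x != 0 by rewrite subr_eq0 eq_sym.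
split; first by exists x; apply: sub_convex_hull; left.
- exists x, <[y - x]>%VS; rewrite dim_vline yx0; split=> // _ /segmentP[t _ ->].
  by rewrite /affine_subspace /= addrC addKr memvZ ?memv_line.
- move=> a U sub; rewrite lt0n dimv_eq0; apply: contra yx0 => /eqP U0.
  have /sub : convex_hull [set x; y] x by apply: sub_convex_hull; left.
  have /sub : convex_hull [set x; y] y by apply: sub_convex_hull; right.
  by rewrite /affine_subspace /= U0 !memv0 !subr_eq0 => /eqP -> /eqP ->.
Qed.

(** A functional that breaks the ties of another one exposes a point, once it
is scaled down so far that it does not affect the strict inequalities. *)
Lemma exposed_tie X x c w : finite_set X -> X x ->
  (forall q, X q -> dot c q <= dot c x) ->
  (forall q, X q -> dot c q = dot c x -> q <> x -> dot w q < dot w x) ->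
  exposed X x.
Proof.
move=> /finite_seqP[s eX] Xx cmax wmax; split=> //.
have [e e0 He] := small_perturbation [seq x - q | q <- s] c w.
exists (c + e *: w) => q Xq qx.
have qs : x - q \in [seq x - q | q <- s] by apply: map_f; move: Xq; rewrite eX.
have [ecq|ncq] := eqVneq (dot c q) (dot c x).
  by rewrite !dot_lin ecq ltrD2l ltr_pM2l // wmax.
by have := He _ qs; rewrite !dotDr !dotNr !subr_gt0 => -> //;
  rewrite lt_neqAle ncq cmax.
Qed.

Lemma edge_segment X F : finite_set X -> edges (convex_hull X) F ->
  exists x y, [/\ x <> y, F = convex_hull [set x; y], exposed X x & exposed X y].
Proof.
move=> finX [[c eF] [[p0 Fp0] [a [U [dimU FU]]] Fmin]].
have [s eX] := (finite_seqP X).1 finX.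
have [w w0 Uw] : exists2 w, w != 0 & forall v, v \in U -> exists k, v = k *: w.
  exists (vpick U); first by rewrite vpick0 -dimv_eq0 dimU.
  suff eU : U = <[vpick U]>%VS by move=> v; rewrite {1}eU => /vlineP.
  apply/esym/eqP; rewrite eqEdim -memvE memv_pick dimU dim_vline vpick0.
  by rewrite -dimv_eq0 dimU.
pose h := dot c p0.
have FE p : F p <-> convex_hull X p /\ dot c p = h.
  move: Fp0; rewrite eF /= => -[Pp0 max0]; split=> -[Pp].
    by move=> max; split=> //; apply/eqP; rewrite eq_le max0 //= max.
  by move=> ep; split=> // y Py; rewrite ep; apply: max0.
have Xh q : X q -> dot c q <= h.
  move=> /sub_convex_hull Pq; by move: Fp0; rewrite eF /= => -[_]; apply.
have [q0 Xq0 hq0] : exists2 q, X q & dot c q = h.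
  apply: contrapT => no; have [Pp0 _] := (FE p0).1 Fp0.
  have cvx0 : convex_set (set0 : set V) by apply/convex_setP.
  suff no' q : X q -> dot c q = h -> set0 q.
    by have [_] := convex_hull_hyperplane cvx0 Xh no' Pp0; apply.
  by move=> Xq hq; apply: no; exists q.
pose sF := [seq q <- s | dot c q == h].
have sFE q : (q \in sF) <-> X q /\ dot c q = h.
  by rewrite mem_filter eX /=; split=> [/andP[/eqP]|[-> ->]]//; rewrite eqxx.
have sF0 : q0 \in sF by apply/sFE.
(* the two extreme points of [X] on the line in direction [w] *)
have [x xs xmin] := seq_argmax (dot (- w)) sF0.
have [y ys ymax] := seq_argmax (dot w) sF0.
have line q : q \in sF -> exists k, q = x + k *: w.
  have inU q' : q' \in sF -> q' - a \in U.
    by move=> /sFE[Xq' hq']; apply: FU; apply/FE; split => //; apply: sub_convex_hull.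
  move=> qs; have [k ek] : exists k, q - x = k *: w.
    apply: Uw; have -> : q - x = (q - a) - (x - a) by rewrite opprB addrA subrK.
    by rewrite memvB ?inU.
  by exists k; rewrite -ek addrC subrK.
have ww := dot_gt0 w0.
have coord q : q \in sF -> exists k,
    [/\ q = x + k *: w, 0 <= k & dot w q = dot w x + k * dot w w].
  move=> qs; have [k ek] := line q qs; exists k.
  have e : dot w q = dot w x + k * dot w w by rewrite {1}ek !dot_lin.
  split=> //; have := xmin q qs; rewrite !dotNl lerN2 e lerDl.
  by rewrite pmulr_lge0.
have [r [ey r0 hy]] := coord y ys.
have [Xx hx] := (sFE x).1 xs; have [Xy hy'] := (sFE y).1 ys.
have seg q : X q -> dot c q = h -> convex_hull [set x; y] q.
  move=> Xq hq; have qs : q \in sF by apply/sFE.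
  have [k [eq k0 hwq]] := coord q qs.
  have kr : k <= r by have := ymax q qs; rewrite hwq hy lerD2l ler_pM2r.
  apply/segmentP; have [r00|rn0] := eqVneq r 0.
    have k00 : k = 0 by apply/eqP; rewrite eq_le k0 -r00 kr.
    by exists 0; rewrite ?lexx ?ler01 // scale0r addr0 eq k00 scale0r addr0.
  have rp : 0 < r by rewrite lt0r rn0.
  exists (k / r); first by rewrite divr_ge0 //= ler_pdivrMr // mul1r.
  by rewrite ey addrAC subrr add0r scalerA divfK.
have FS : F = convex_hull [set x; y].
  apply/seteqP; split=> p.
    move=> /FE[Pp hp].
    by have [_] := convex_hull_hyperplane (@convex_convex_hull _ _ _) Xh seg Pp; apply.
  move=> Sp; apply/FE; split.
    by apply: sub_smallest2r p Sp => [|_ [->|->]];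
      first exact: convex_convex_hull.
  have /segmentP[t _ ->] := Sp.
  by rewrite !dot_lin hx hy'; ring.
have xy : x <> y.
  move=> xy; have : (1 <= \dim (0 : {vspace V}))%N.
    apply: (Fmin x); rewrite FS => _ /segmentP[t _ ->].
    by rewrite /affine_subspace /= -xy subrr scaler0 addr0 subrr mem0v.
  by rewrite dimv0.
have cx q : X q -> dot c q <= dot c x by rewrite hx; apply: Xh.
have cy q : X q -> dot c q <= dot c y by rewrite hy'; apply: Xh.
exists x, y; split=> //.
- apply: (@exposed_tie X x c (- w)) => // q Xq; rewrite hx => hq qx.
  have qs : q \in sF by apply/sFE.
  have [k [eq k0 hwq]] := coord q qs.
  rewrite !dotNl ltrN2 hwq ltrDl mulr_gt0 // lt0r k0 andbT.
  by apply: contra_not_neq qx => k00; rewrite eq k00 scale0r addr0.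
- apply: (@exposed_tie X y c w) => // q Xq; rewrite hy' => hq qy.
  have qs : q \in sF by apply/sFE.
  have [k [eq k0 hwq]] := coord q qs.
  rewrite hwq hy ltrD2l ltr_pM2r // lt_neqAle.
  have -> : k <= r by have := ymax q qs; rewrite hwq hy lerD2l ler_pM2r.
  by rewrite andbT; apply: contra_not_neq qy => kr; rewrite eq kr.
Qed.

Lemma adjacent_exposed X x y : finite_set X -> adjacent (convex_hull X) x y ->
  exposed X x /\ exposed X y.
Proof.
move=> finX [xy /(edge_segment finX)[x' [y' [_ e ex ey]]]].
by have [[-> ->]|[-> ->]] := segment_inj e.
Qed.

Lemma finite_edges X : finite_set X -> finite_set (edges (convex_hull X)).
Proof.
move=> finX.
apply: (@sub_finite_set _ _
  ((fun xy => convex_hull [set xy.1; xy.2]) @` (X `*` X))).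
  move=> F /(edge_segment finX)[x [y [_ -> [Xx _] [Xy _]]]].
  by exists (x, y).
by apply: finite_image; apply: finite_setX.
Qed.

(** The improvement step of the simplex method. If [c] exposes [x], the points
[q] of [X] other than [x] have the slopes [r q = (q - x) / dot c (x - q)], which
lie in a hyperplane and determine the rays from [x] through [q]. A generic
perturbation [v] of [u] has its maximum [m] at a single slope, so [v + m c] has
its maximum over [X] exactly on a ray from [x]: this is the edge. The
perturbation respects the strict inequalities between values of [u] at slopes,
so [u] increases along this ray because it does towards [p]. *)
Lemma improving_edge X x p u : finite_set X -> exposed X x -> X p ->
  0 < dot u (p - x) ->
  exists2 y, adjacent (convex_hull X) x y & 0 < dot u (y - x).
Proof.
move=> finX [Xx [c cx]] Xp up.
have [s eX] := (finite_seqP X).1 finX.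
pose r q := (dot c (x - q))^-1 *: (q - x).
have cpos q : X q -> q <> x -> 0 < dot c (x - q).
  by move=> Xq qx; rewrite dotDr dotNr subr_gt0 cx.
have rE q : X q -> q <> x -> q = x + dot c (x - q) *: r q.
  move=> Xq qx; rewrite scalerA divff ?gt_eqF ?cpos // scale1r.
  by rewrite addrC subrK.
pose t := [seq q <- s | q != x].
have tE q : (q \in t) <-> X q /\ q <> x.
  by rewrite mem_filter eX; split=> [/andP[/eqP]|[? /eqP ->]].
have px : p <> x by move=> px; move: up; rewrite px subrr dot0r ltxx.
have tp : p \in t by apply/tE.
have [v Hv] : exists v, forall a b, a \in t -> b \in t -> r a != r b ->
    dot v (r a) != dot v (r b) /\
    (dot u (r b) < dot u (r a) -> dot v (r b) < dot v (r a)).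
  have [v Hv] := generic_perturbation [seq r a - r b | a <- t, b <- t] u.
  exists v => a b ta tb; rewrite -subr_eq0.
  by move=> /(Hv _ (allpairs_f _ ta tb)); rewrite !dotDr !dotNr subr_eq0 !subr_gt0.
have [q0 tq0 q0max] := seq_argmax (fun q => dot v (r q)) tp.
have [Xq0 q0x] := (tE q0).1 tq0.
have vsep q : X q -> q <> x -> r q = r q0 \/ dot v (r q) < dot v (r q0).
  move=> Xq qx; have tq : q \in t by apply/tE.
  have [->|rq] := eqVneq (r q) (r q0); [by left|right].
  by rewrite lt_neqAle q0max ?andbT //; case: (Hv q q0 tq tq0 rq).
have up0 : 0 < dot u (r q0).
  have urp : 0 < dot u (r p) by rewrite dotZr mulr_gt0 ?invr_gt0 ?cpos.
  rewrite ltNge; apply/negP => u0.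
  have lt := le_lt_trans u0 urp.
  have rpq : r p != r q0 by apply: contraTneq lt => ->; rewrite ltxx.
  have [_ /(_ lt)] := Hv p q0 tp tq0 rpq.
  by rewrite ltNge q0max.
pose m := dot v (r q0).
pose f := v + m *: c.
have fq q : X q -> q <> x -> dot f q = dot f x + dot c (x - q) * (dot v (r q) - m).
  move=> Xq qx; have cr : dot c (r q) = -1.
    by rewrite dotZr -(opprB x q) dotNr mulrN mulVf // gt_eqF ?cpos.
  rewrite {1}(rE q Xq qx) dotDr dotZr [dot f (r q)]dotDl dotZl cr; ring.
(* the point of [X] on this ray that is farthest from [x] *)
have [y [Xy yx] ymin] : exists2 y, X y /\ y <> x & r y = r q0 /\
    forall q, X q -> q <> x -> r q = r q0 -> dot c (x - q) <= dot c (x - y).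
  pose t0 := [seq q <- t | r q == r q0].
  have t0E q : (q \in t0) <-> [/\ X q, q <> x & r q = r q0].
    rewrite mem_filter; split=> [/andP[/eqP ? /tE[]]//|[? ? ->]].
    by rewrite eqxx; apply/tE.
  have q00 : q0 \in t0 by apply/t0E.
  have [y /t0E[Xy yx ry] ymax] := seq_argmax (fun q => dot c (x - q)) q00.
  by exists y => //; split=> // q Xq qx rq; apply: ymax; apply/t0E.
have [ry ymax] := ymin.
have yx0 : 0 < dot c (x - y) by apply: cpos.
have fy : dot f y = dot f x by rewrite fq // ry subrr mulr0 addr0.
have fmax q : X q -> dot f q <= dot f x.
  move=> Xq; have [->//|/eqP qx] := eqVneq q x.
  rewrite fq // gerDl; apply: mulr_ge0_le0; first by rewrite ltW ?cpos.
  by have [->|/ltW] := vsep q Xq qx; rewrite subr_le0.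
have seg q : X q -> dot f q = dot f x -> convex_hull [set x; y] q.
  move=> Xq; have [-> _|/eqP qx] := eqVneq q x.
    by apply: sub_convex_hull; left.
  rewrite fq // => fqx.
  have rq : r q = r q0.
    have [//|lt] := vsep q Xq qx.
    have : dot c (x - q) * (dot v (r q) - m) < 0.
      by rewrite pmulr_rlt0 ?cpos // subr_lt0.
    by move=> {}lt; exfalso; move: lt fqx; lra.
  apply/segmentP; exists (dot c (x - q) / dot c (x - y)).
    rewrite divr_ge0 ?(ltW (cpos _ _ _)) //= ler_pdivrMr // mul1r.
    exact: ymax.
  rewrite [in RHS](_ : y - x = dot c (x - y) *: r q0).
    by rewrite scalerA divfK ?gt_eqF // -rq -rE.
  by rewrite -ry {1}(rE y Xy yx) addrC addKr.
have xy : x <> y by move/esym.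
exists y; last first.
  by rewrite {1}(rE y Xy yx) addrC addKr ry dotZr mulr_gt0.
split=> //; split; last exact: affine_dim_segment.
exists f; apply/seteqP; split=> z.
  move=> Sz; split.
    by apply: sub_smallest2r z Sz => [|_ [->|->]];
      first exact: convex_convex_hull.
  have /segmentP[k _ ez] := Sz.
  have -> : dot f z = dot f x by rewrite ez dotDr dotZr dotDr dotNr fy; ring.
  exact: convex_hull_le.
move=> [Pz zmax].
have [zle zseg] := convex_hull_hyperplane (@convex_convex_hull _ _ _) fmax seg Pz.
apply: zseg; apply/eqP; rewrite eq_le zle zmax //; exact: sub_convex_hull.
Qed.

Lemma edge_local_max X x u : finite_set X -> exposed X x ->
  (forall y, adjacent (convex_hull X) x y -> dot u (y - x) <= 0) ->
  forall p, convex_hull X p -> dot u p <= dot u x.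
Proof.
move=> finX ex loc; apply: convex_hull_le => p Xp.
rewrite leNgt -subr_gt0 -dotNr -dotDr; apply/negP => up.
have [y xy] := improving_edge finX ex Xp up.
by rewrite ltNge loc.
Qed.

(** A vector orthogonal to all edges at [x] is, with its opposite, maximal over
the polytope at [x], so the polytope lies in a translate of its orthogonal
complement. *)
Lemma edges_span X x u : finite_set X -> affine_dim (convex_hull X) N ->
  exposed X x ->
  (forall y, adjacent (convex_hull X) x y -> dot u (y - x) = 0) -> u = 0.
Proof.
move=> finX [_ _ dimP] ex orth.
have const p : convex_hull X p -> dot u p = dot u x.
  move=> Pp; apply/eqP; rewrite eq_le (edge_local_max finX ex) //; last first.
    by move=> y /orth ->.
  rewrite -lerN2 -!dotNl (edge_local_max finX ex) //.
  by move=> y /orth e; rewrite dotNl e oppr0.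
pose K := lker (linfun (mulmxr u^T : V -> 'M_1)).
have KE v : (v \in K) = (dot v u == 0).
  rewrite memv_ker lfunE /= dotE; apply/eqP/eqP => [->|e]; first by rewrite mxE.
  by apply/rowP => i; rewrite ord1 e mxE.
have : (N <= \dim K)%N.
  apply: (dimP x) => p Pp; rewrite /affine_subspace /= KE.
  by rewrite dotC dotDr dotNr const // subrr.
move=> dimK; have /eqP eK : K == fullv.
  by rewrite eqEdim subvf dimvf /dim /= mul1n.
by apply/eqP; rewrite -dot_eq0 -KE eK memvf.
Qed.

End Edges.

(** * Symmetries *)

Section Isometries.
Variables (R : realType) (N : nat).
Local Notation V := 'rV[R]_N.
Implicit Types (X P F : set V) (g : V -> V) (x y : V).

Lemma dot_polarization (u v u' v' : V) :
  dot u u = dot u' u' -> dot v v = dot v' v' ->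
  dot (u - v) (u - v) = dot (u' - v') (u' - v') -> dot u v = dot u' v'.
Proof.
move=> eu ev; rewrite !(dotDl, dotDr, dotNl, dotNr) eu ev (dotC v) (dotC v'); lra.
Qed.

(** Polarization makes [x |-> g x - g 0] preserve inner products, so the rows of
the linear part are orthonormal, and they give the coordinates of an image. *)
Lemma isometry_affine g : Defs.isometry g ->
  linear_part g *m (linear_part g)^T = 1%:M /\
  forall x, g x = g 0 + x *m linear_part g.
Proof.
move=> iso; set A := linear_part g.
pose h x := g x - g 0.
have dist x y : dot (g x - g y) (g x - g y) = dot (x - y) (x - y).
  by rewrite -!enorm_sqr iso.
have hh x : dot (h x) (h x) = dot x x by rewrite dist subr0.
have hdot x y : dot (h x) (h y) = dot x y.
  by apply: dot_polarization; rewrite ?hh // /h opprB addrA subrK dist.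
have rowA i : row i A = h (delta_mx 0 i) by rewrite rowK.
have hA x : h x *m A^T = x.
  apply/rowP => i; transitivity (dot (h x) (row i A)).
    by rewrite mxE; apply: eq_bigr => j _; rewrite !mxE.
  by rewrite rowA hdot dotE trmx_delta -colE mxE.
have AAT : A *m A^T = 1%:M.
  by apply/row_matrixP => i; rewrite row_mul rowA hA rowE mulmx1.
split=> // x; rewrite -[x in RHS]hA -mulmxA (mulmx1C AAT) mulmx1.
by rewrite addrC subrK.
Qed.

Lemma isometryB g x y : Defs.isometry g -> g x - g y = (x - y) *m linear_part g.
Proof.
move=> /isometry_affine[_ gE].
by rewrite (gE x) (gE y) opprD addrACA subrr add0r mulmxBl.
Qed.

Lemma isometry_inj g : Defs.isometry g -> injective g.
Proof.
move=> iso x y gxy; apply/eqP; rewrite -subr_eq0 -dot_eq0 -enorm_sqr -iso.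
by rewrite gxy subrr enorm_sqr dot0l.
Qed.

Lemma image_segment g x y : Defs.isometry g ->
  g @` convex_hull [set x; y] = convex_hull [set g x; g y].
Proof.
move=> iso; have [_ gE] := isometry_affine iso.
have gt t : g (x + t *: (y - x)) = g x + t *: (g y - g x).
  by rewrite isometryB // scalemxAl gE mulmxDl addrA -gE.
apply/seteqP; split=> [_ [_ /segmentP[t t01 ->] <-]|_ /segmentP[t t01 ->]].
  by apply/segmentP; exists t.
by exists (x + t *: (y - x)) => //; apply/segmentP; exists t.
Qed.

(** The symmetries of [P], proper or not. *)
Definition symmetry P g := Defs.isometry g /\ g @` P = P.

Lemma symmetry_inv P g : symmetry P g ->
  exists2 g', symmetry P g' & cancel g g' /\ cancel g' g.
Proof.
move=> [iso gP]; have [AAT gE] := isometry_affine iso.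
pose g' x := (x - g 0) *m (linear_part g)^T.
have gK : cancel g g'.
  by move=> x; rewrite /g' gE addrAC subrr add0r -mulmxA AAT mulmx1.
have g'K : cancel g' g.
  by move=> x; rewrite gE /g' -mulmxA (mulmx1C AAT) mulmx1 addrC subrK.
exists g' => //; split.
  by move=> x y; rewrite -{2}(g'K x) -{2}(g'K y) iso.
apply/seteqP; split=> [_ [x Px <-]|x Px].
  by move: Px; rewrite -{1}gP => -[y Py <-]; rewrite gK.
by exists (g x); rewrite ?gK // -gP; exists x.
Qed.

Lemma symmetry_edge X g F : finite_set X -> symmetry (convex_hull X) g ->
  edges (convex_hull X) F -> edges (convex_hull X) (g @` F).
Proof.
move=> finX [iso gP] eF; have [AAT gE] := isometry_affine iso.
have [x [y [xy eFxy _ _]]] := edge_segment finX eF.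
split; last first.
  rewrite eFxy image_segment //; apply: affine_dim_segment.
  by move/(isometry_inj iso).
have [[c ->] _] := eF; exists (c *m linear_part g).
have [k cg] : exists k, forall p, dot (c *m linear_part g) (g p) = k + dot c p.
  exists (dot (c *m linear_part g) (g 0)) => p.
  by rewrite (gE p) dotDr [dot _ (p *m _)]dot_mulmx -mulmxA AAT mulmx1.
apply/seteqP; split=> [_ [p [Pp pmax] <-]|q [Pq qmax]].
  split; first by rewrite -gP; exists p.
  by move=> q; rewrite -{1}gP => -[p' Pp' <-]; rewrite !cg lerD2l pmax.
move: Pq qmax; rewrite -{1}gP => -[p Pp <-] pmax; exists p => //; split=> // p' Pp'.
have : convex_hull X (g p') by rewrite -gP; exists p'.
by move=> /pmax; rewrite !cg lerD2l.
Qed.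

(** With this bijection sums over the edges can be reindexed by a symmetry. *)
Lemma symmetry_edges_bij X g : finite_set X -> symmetry (convex_hull X) g ->
  set_bij (edges (convex_hull X)) (edges (convex_hull X)) (image^~ g).
Proof.
move=> finX symg; have [g' symg' [gK g'K]] := symmetry_inv symg.
have K (f f' : V -> V) (F : set V) : cancel f f' -> f' @` (f @` F) = F.
  move=> fK; rewrite image_comp; have -> : f' \o f = id by apply/funext.
  exact: image_id.
split.
- by move=> F; apply: symmetry_edge.
- by move=> F F' _ _ e; rewrite -(K _ _ F gK) e K.
- by move=> F eF; exists (g' @` F); [apply: symmetry_edge|apply: K].
Qed.

End Isometries.

(** * Determinants and projections *)

Section LinearAlgebra.
Variables (R : realType) (N : nat).
Local Notation V := 'rV[R]_N.

(** Both sides are the determinant of the block matrix [[1, v], [u, 1]], factored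
into a lower and an upper triangular one in the two possible orders. *)
Lemma det_sub_rank1 (n : nat) (u : 'cV[R]_n) (v : 'rV[R]_n) :
  \det (1%:M - u *m v) = 1 - (v *m u) 0 0.
Proof.
have el : block_mx (1%:M : 'M_1) v u 1%:M =
    block_mx 1%:M 0 u 1%:M *m block_mx 1%:M v 0 (1%:M - u *m v).
  rewrite mulmx_block !(mul1mx, mul0mx, mulmx0, mulmx1, addr0).
  by rewrite addrC subrK.
have er : block_mx (1%:M : 'M_1) v u 1%:M =
    block_mx (1%:M - v *m u) v 0 1%:M *m block_mx 1%:M 0 u 1%:M.
  by rewrite mulmx_block !(mul1mx, mul0mx, mulmx0, mulmx1, add0r, subrK).
have := congr1 determinant el; rewrite er !det_mulmx !det_lblock !det_ublock.
by rewrite !det1 !mul1r !mulr1 => <-; rewrite det_mx11 !mxE.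
Qed.

(** With the rows of [B] forming a basis of [S], the matrix is
[B^T (B B^T)^-1 B], whose trace is that of an identity matrix of size [\dim S]. *)
Lemma orth_proj_matrix (S : {vspace V}) : exists Q : 'M[R]_N,
  [/\ Q *m Q^T = Q, \tr Q = (\dim S)%:R & forall x, orth_proj S x = x *m Q].
Proof.
pose B : 'M[R]_(\dim S, N) := \matrix_i (vbasis S)`_i.
have rowB i : row i B = (vbasis S)`_i by rewrite rowK.
have BS (c : 'rV_(\dim S)) : c *m B \in S.
  rewrite mulmx_sum_row; apply: memv_suml => i _; rewrite rowB memvZ //.
  by rewrite vbasis_mem // mem_nth // size_tuple.
have SB x : x \in S -> exists c, x = c *m B.
  move=> /coord_vbasis ->; exists (\row_i coord (vbasis S) i x).
  by rewrite mulmx_sum_row; apply: eq_bigr => i _; rewrite rowB mxE.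
have freeB (c : 'rV_(\dim S)) : c *m B = 0 -> c = 0.
  move=> cB; apply/rowP => i; rewrite mxE.
  apply: (freeP (basis_free (vbasisP S)) (c 0)).
  by rewrite -[RHS]cB mulmx_sum_row; apply: eq_bigr => j _; rewrite rowB.
pose K := B *m B^T.
have Ku : K \in unitmx.
  rewrite -row_free_unit; apply: inj_row_free => v vK; apply: freeB.
  by apply/eqP; rewrite -dot_eq0 dotE trmx_mul mulmxA -(mulmxA v) vK mul0mx mxE.
pose Q := B^T *m (invmx K *m B).
have KT : K^T = K by rewrite trmx_mul trmxK.
have QT : Q^T = Q by rewrite /Q !trmx_mul trmxK trmx_inv KT mulmxA.
exists Q; split.
- by rewrite QT /Q -!mulmxA (mulmxA B) (mulmxA (invmx K)) mulVmx // mul1mx.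
- by rewrite mxtrace_mulC -mulmxA mulVmx // mxtrace1.
move=> x; have Qorth (c : 'rV_(\dim S)) : dot (x - x *m Q) (c *m B) = 0.
  rewrite dotE trmx_mul (mulmxA (x - x *m Q)).
  have -> : (x - x *m Q) *m B^T = 0.
    by rewrite mulmxBl /Q -!mulmxA mulVmx // mulmx1 subrr.
  by rewrite mul0mx mxE.
apply: xget_unique => [|y [yS orth]].
  by split=> [|_ /SB[c ->]//]; rewrite /Q !mulmxA BS.
have /SB[c yc] := yS; have [c' Qc'] : exists c', x *m Q = c' *m B.
  by exists (x *m B^T *m invmx K); rewrite !mulmxA.
have dS : y - x *m Q = (c - c') *m B by rewrite yc Qc' mulmxBl.
apply/eqP; rewrite -subr_eq0 -dot_eq0.
have {1}-> : y - x *m Q = (x - x *m Q) - (x - y).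
  by rewrite opprB [RHS]addrC addrA subrK.
rewrite dotDl dotNl {1}dS Qorth orth ?subrr //.
by rewrite dS BS.
Qed.

End LinearAlgebra.

(** * Sums over the edges *)

Section EdgeSums.
Variables (R : realType) (N : nat).
Local Notation V := 'rV[R]_N.
Implicit Types (X P F : set V) (g : V -> V) (x y z : V).

Lemma endpoints_segment x y :
  endpoints (convex_hull [set x; y]) = (x, y) \/
  endpoints (convex_hull [set x; y]) = (y, x).
Proof.
rewrite /endpoints; set D := (D in xget _ D).
have : D (xget (0, 0) D) by apply: xgetPex; exists (x, y).
case: (xget _ _) => a b /= /segment_inj[[-> ->]|[-> ->]]; [by left|by right].
Qed.

Lemma endpoints_image X g F : finite_set X -> edges (convex_hull X) F ->
  Defs.isometry g ->
  let e := endpoints F in let e' := endpoints (g @` F) in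
  e' = (g e.1, g e.2) \/ e' = (g e.2, g e.1).
Proof.
move=> finX /(edge_segment finX)[x [y [_ -> _ _]]] iso /=.
rewrite image_segment //.
have [->|->] := endpoints_segment (g x) (g y);
have [->|->] := endpoints_segment x y; by [left|right].
Qed.

Definition edge_vector F : V := (endpoints F).1 - (endpoints F).2.

Definition edge_tensor P : 'M[R]_N :=
  \sum_(F \in edges P) (edge_vector F)^T *m edge_vector F.

Lemma sum_sq_proj_edgesE X S : finite_set X -> exists Q : 'M[R]_N,
  [/\ \tr Q = (\dim S)%:R &
  sum_sq_proj_edges S (convex_hull X) = \tr (edge_tensor (convex_hull X) *m Q)].
Proof.
move=> finX; have [Q [QQ trQ projE]] := orth_proj_matrix S; exists Q; split=> //.
rewrite /sum_sq_proj_edges /edge_tensor !fsbig_finite; try exact: finite_edges.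
rewrite mulmx_suml raddf_sum; apply: eq_bigr => F _.
rewrite /proj_edge_length enorm_sqr projE -/(edge_vector F) dotE trmx_mul.
rewrite !mulmxA -(mulmxA (edge_vector F)) QQ -trace_mx11.
by rewrite -mxtrace_mulC mulmxA.
Qed.

Lemma sum_sq_edgesE X : finite_set X ->
  sum_sq_edges (convex_hull X) = \tr (edge_tensor (convex_hull X)).
Proof.
move=> finX; rewrite /sum_sq_edges /edge_tensor !fsbig_finite; try exact: finite_edges.
rewrite raddf_sum; apply: eq_bigr => F _.
by rewrite /edge_length enorm_sqr dotE -trace_mx11 mxtrace_mulC.
Qed.

Lemma edge_tensor_trmx X : finite_set X ->
  (edge_tensor (convex_hull X))^T = edge_tensor (convex_hull X).
Proof.
move=> finX; rewrite /edge_tensor fsbig_finite; last exact: finite_edges.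
by rewrite raddf_sum; apply: eq_bigr => F _; rewrite /= trmx_mul trmxK.
Qed.

(** Carrying an edge along [g] multiplies its vector by the linear part, up to a
sign that the tensor does not see. *)
Lemma edge_tensor_comm X g : finite_set X -> symmetry (convex_hull X) g ->
  linear_part g *m edge_tensor (convex_hull X) =
  edge_tensor (convex_hull X) *m linear_part g.
Proof.
move=> finX symg; have [iso gP] := symg; have [AAT _] := isometry_affine iso.
set P := convex_hull X; set A := linear_part g.
have {1}-> : edge_tensor P = A^T *m edge_tensor P *m A.
  rewrite {1}/edge_tensor (reindex_fsbig _ _ _ _ (symmetry_edges_bij finX symg)).
  rewrite /edge_tensor !fsbig_finite; try exact: finite_edges.
  rewrite mulmx_sumr mulmx_suml big_seq [RHS]big_seq; apply: eq_bigr => F.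
  rewrite in_fset_set ?inE; last exact: finite_edges.
  move=> eF; have : edge_vector (g @` F) = edge_vector F *m A \/
      edge_vector (g @` F) = - (edge_vector F *m A).
    rewrite /edge_vector; have /= [->|->] := endpoints_image finX eF iso; [left|right].
      exact: isometryB.
    by rewrite /= isometryB // -mulNmx opprB.
  by case=> ->; rewrite ?linearN /= ?mulNmx ?mulmxN ?opprK trmx_mul !mulmxA.
by rewrite !mulmxA AAT mul1mx.
Qed.

(** The centroid of the midpoints of the edges is such a point. *)
Lemma symmetry_fixpoint X : finite_set X -> edges (convex_hull X) !=set0 ->
  exists z, forall g, symmetry (convex_hull X) g -> g z = z.
Proof.
move=> finX [F0 eF0]; set P := convex_hull X.
have finE : finite_set (edges P) by apply: finite_edges.
pose mid F : V := 2^-1 *: ((endpoints F).1 + (endpoints F).2).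
pose s : seq (set V) := finmap.enum_fset (fset_set (edges P)).
have sE F : (F \in s) = (F \in edges P) by exact: in_fset_set.
pose n := size s.
have n0 : (n%:R : R) != 0.
  rewrite pnatr_eq0 -lt0n; have : F0 \in s by rewrite sE inE.
  by rewrite /n; case: (s).
exists (n%:R^-1 *: \sum_(F \in edges P) mid F) => g symg.
have [iso _] := symg; have [_ gE] := isometry_affine iso.
set z := _ *: _; have {1}-> : z = n%:R^-1 *: \sum_(F \in edges P) (mid F) by [].
rewrite /z [in RHS](reindex_fsbig _ _ _ _ (symmetry_edges_bij finX symg)).
rewrite !fsbig_finite // -/s.
transitivity (n%:R^-1 *: \sum_(F <- s) (g 0 + mid F *m linear_part g)).
  rewrite gE big_split /= big_const_seq count_predT iter_addr_0 -/n.
  by rewrite scalerDr -scaler_nat scalerA mulVf // scale1r -mulmx_suml scalemxAl.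
congr (_ *: _); rewrite big_seq [RHS]big_seq; apply: eq_bigr => F.
rewrite sE inE => eF.
have -> : mid (g @` F) = 2^-1 *: (g (endpoints F).1 + g (endpoints F).2).
  by rewrite /mid; have /= [->|->] := endpoints_image finX eF iso; rewrite //= addrC.
rewrite (gE (endpoints F).1) (gE (endpoints F).2) addrACA scalerDr -mulmxDl.
rewrite scalemxAl -/(mid F).
by rewrite -mulr2n -scaler_nat scalerA mulVf ?pnatr_eq0 // scale1r.
Qed.

End EdgeSums.

(** * Edge-transitivity *)

Section Transitivity.
Variables (R : realType) (N : nat).
Local Notation V := 'rV[R]_N.
Implicit Types (X P F : set V) (g : V -> V) (x y z : V) (T : 'M[R]_N).

Lemma proper_symmetry P g : proper_symmetries P g -> symmetry P g.
Proof. by case. Qed.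

Lemma adjacent_transitive P x y x' y' :
  transitive_on_edges (proper_symmetries P) P ->
  adjacent P x y -> adjacent P x' y' ->
  exists2 g, proper_symmetries P g &
    (x' = g x /\ y' = g y) \/ (x' = g y /\ y' = g x).
Proof.
move=> trans [_ e] [_ e']; have [g Gg gF] := trans _ _ e e'; exists g => //.
have [iso _] := proper_symmetry Gg.
by move: gF; rewrite image_segment // => /esym/segment_inj.
Qed.

Lemma symmetryB P z g x : symmetry P g -> g z = z ->
  g x - z = (x - z) *m linear_part g.
Proof. by move=> [iso _] gz; rewrite -{1}gz isometryB. Qed.

Lemma symmetry_dot P z g x y : symmetry P g -> g z = z ->
  dot (g x - z) (g y - z) = dot (x - z) (y - z).
Proof.
move=> [iso gP] gz; have [AAT _] := isometry_affine iso.
by rewrite -{1 2}gz !isometryB // dot_mulmx -mulmxA AAT mulmx1.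
Qed.

Lemma symmetry_eigenvector P z T g x k : symmetry P g -> g z = z ->
  linear_part g *m T = T *m linear_part g ->
  (x - z) *m T = k *: (x - z) -> (g x - z) *m T = k *: (g x - z).
Proof.
move=> symg gz commT xk; rewrite (symmetryB _ symg gz).
by rewrite -mulmxA commT // mulmxA xk scalemxAl.
Qed.

(** For an edge [x, y'] at [x] the two numbers [dot (y' - z) (x - z)] and
[dot (y' - z) ((x - z) *m T)] do not depend on [y'], whichever way round a
symmetry carries [x, y] to it. So a combination of [x - z] and [(x - z) *m T] is
orthogonal to all edges at [x], hence zero; should the coefficient of
[(x - z) *m T] vanish, then [x - z] itself is zero. *)
Lemma endpoint_eigenvector X z T x y : finite_set X ->
  affine_dim (convex_hull X) N ->
  transitive_on_edges (proper_symmetries (convex_hull X)) (convex_hull X) ->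
  (forall g, symmetry (convex_hull X) g -> g z = z) ->
  T^T = T ->
  (forall g, symmetry (convex_hull X) g ->
    linear_part g *m T = T *m linear_part g) ->
  adjacent (convex_hull X) x y ->
  exists l, (x - z) *m T = l *: (x - z).
Proof.
move=> finX dimP trans fix_z symT commT xy.
set P := convex_hull X in trans fix_z commT xy.
have [ex _] := adjacent_exposed finX xy.
set a := x - z; set b := y - z.
have inv y' : adjacent P x y' ->
    dot a (y' - z) = dot a b /\ dot (a *m T) (y' - z) = dot (a *m T) b.
  move=> xy'; have [g Gg] := adjacent_transitive trans xy xy'.
  have symg := proper_symmetry Gg; have gz := fix_z _ symg.
  have gT (u v : V) : dot ((g u - z) *m T) (g v - z) = dot ((u - z) *m T) (v - z).
    have [[iso _] [AAT _]] := (symg, isometry_affine symg.1).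
    rewrite -{1 2}gz !isometryB // -mulmxA commT // mulmxA dot_mulmx.
    by rewrite -mulmxA AAT mulmx1.
  case=> -[ex' ey']; split; rewrite ey' /a {1}ex'.
  - by rewrite (symmetry_dot _ _ symg gz).
  - by rewrite gT.
  - by rewrite (symmetry_dot _ _ symg gz) dotC.
  - by rewrite gT dot_mulmx symT dotC.
pose r := dot a (b - a); pose p := dot (a *m T) (b - a).
have orth : r *: (a *m T) - p *: a = 0.
  apply: (edges_span finX dimP ex) => y' /inv[e1 e2].
  have -> : y' - x = (y' - z) - a by rewrite /a opprB addrA subrK.
  rewrite dotDl dotNl !dotZl [dot a _]dotDr [dot (a *m T) _]dotDr e1 e2.
  by rewrite -!dotDr -/r -/p mulrC subrr.
have [r0|r0] := eqVneq r 0; last first.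
  exists (r^-1 * p); apply: (scalerI r0); rewrite scalerA mulrA mulfV // mul1r.
  by apply/eqP; rewrite -subr_eq0 orth.
have -> : a = 0; last by exists 0; rewrite mul0mx scaler0.
apply: (edges_span finX dimP ex) => y' /inv[e1 _].
have -> : y' - x = (y' - z) - a by rewrite /a opprB addrA subrK.
by rewrite dotDr e1 -dotDr.
Qed.

(** Each edge at [x] is then an eigenvector, and these edges span. *)
Lemma scalar_tensor X z T x y l : finite_set X ->
  affine_dim (convex_hull X) N ->
  transitive_on_edges (proper_symmetries (convex_hull X)) (convex_hull X) ->
  (forall g, symmetry (convex_hull X) g -> g z = z) ->
  T^T = T ->
  (forall g, symmetry (convex_hull X) g ->
    linear_part g *m T = T *m linear_part g) ->
  adjacent (convex_hull X) x y ->
  (x - z) *m T = l *: (x - z) -> (y - z) *m T = l *: (y - z) -> T = l%:M.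
Proof.
move=> finX dimP trans fix_z symT commT xy xl yl.
have [ex _] := adjacent_exposed finX xy.
have img g (u : V) : proper_symmetries (convex_hull X) g ->
    (u - z) *m T = l *: (u - z) -> (g u - z) *m T = l *: (g u - z).
  move=> /proper_symmetry symg.
  exact: symmetry_eigenvector symg (fix_z _ symg) (commT _ symg).
suff vT (v : V) : v *m T = l *: v.
  by apply/row_matrixP => i; rewrite !rowE vT mul_mx_scalar.
apply/eqP; rewrite -subr_eq0; apply/eqP.
apply: (edges_span finX dimP ex) => y' xy'.
have [g Gg gxy] := adjacent_transitive trans xy xy'.
have y'l : (y' - z) *m T = l *: (y' - z).
  by case: gxy => -[_ ->]; apply: img.
have -> : y' - x = (y' - z) - (x - z) by rewrite opprB addrA subrK.
rewrite dotDl dotNl dot_mulmx symT mulmxBl y'l xl dotZl -scalerBr dotZr.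
by rewrite subrr.
Qed.

(** Orthogonality excludes a symmetry that carries [y] to [x]. *)
Lemma orthogonal_orbits_neighbour X z x y y' :
  transitive_on_edges (proper_symmetries (convex_hull X)) (convex_hull X) ->
  x <> z ->
  (forall g, symmetry (convex_hull X) g -> dot (x - z) (g y - z) = 0) ->
  adjacent (convex_hull X) x y -> adjacent (convex_hull X) x y' ->
  exists2 g, proper_symmetries (convex_hull X) g & x = g x /\ y' = g y.
Proof.
move=> trans xz orth xy xy'.
have [g Gg [?|[xg _]]] := adjacent_transitive trans xy xy'; first by exists g.
have := orth g (proper_symmetry Gg); rewrite -xg => /eqP.
by rewrite dot_eq0 subr_eq0 => /eqP.
Qed.

Lemma orthogonal_orbits_span X z x y w : finite_set X ->
  affine_dim (convex_hull X) N ->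
  transitive_on_edges (proper_symmetries (convex_hull X)) (convex_hull X) ->
  x <> z ->
  (forall g, symmetry (convex_hull X) g -> dot (x - z) (g y - z) = 0) ->
  adjacent (convex_hull X) x y ->
  dot w (x - z) = 0 ->
  (forall g, symmetry (convex_hull X) g -> dot w (g y - z) = 0) -> w = 0.
Proof.
move=> finX dimP trans xz orth xy wx wy.
have [ex _] := adjacent_exposed finX xy.
apply: (edges_span finX dimP ex) => y' xy'.
have [g /proper_symmetry symg [_ ->]] :=
  orthogonal_orbits_neighbour trans xz orth xy xy'.
have -> : g y - x = (g y - z) - (x - z) by rewrite opprB addrA subrK.
by rewrite dotDr dotNr wy // wx subrr.
Qed.

(** The difference between [g x - z] and its projection to the line of [x - z]
is orthogonal to all edges at [x]. *)
Lemma orthogonal_orbits_line X z x y g : finite_set X ->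
  affine_dim (convex_hull X) N ->
  transitive_on_edges (proper_symmetries (convex_hull X)) (convex_hull X) ->
  x <> z ->
  (forall g h, symmetry (convex_hull X) g -> symmetry (convex_hull X) h ->
    dot (g x - z) (h y - z) = 0) ->
  adjacent (convex_hull X) x y -> symmetry (convex_hull X) g ->
  exists k, g x - z = k *: (x - z).
Proof.
move=> finX dimP trans xz orth xy symg.
have symid : symmetry (convex_hull X) id by split; [move=> ? ?|rewrite image_id].
have a0 : dot (x - z) (x - z) != 0 by rewrite dot_eq0 subr_eq0; apply/eqP.
pose k := dot (g x - z) (x - z) / dot (x - z) (x - z); exists k.
apply/eqP; rewrite -subr_eq0; apply/eqP.
apply: (orthogonal_orbits_span finX dimP trans xz _ xy) => [h symh||h symh].
- exact: (orth id).
- by rewrite dotDl dotNl dotZl divfK // subrr.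
- by rewrite dotDl dotNl dotZl orth // (orth id) // mulr0 subrr.
Qed.

(** The orbits of [x] and [y] lie on two orthogonal lines through [z]. The edges
at [x] span, so [x] has a second neighbour, which can only be the reflection of
[y] at [z]. The linear part of a symmetry that carries one of the two edges onto
the other fixes [x - z] and negates [y - z]; as these two vectors span, it is the
reflection in the direction of [y - z], and the symmetry is not proper. *)
Lemma no_orthogonal_orbits X z x y : finite_set X ->
  affine_dim (convex_hull X) N ->
  transitive_on_edges (proper_symmetries (convex_hull X)) (convex_hull X) ->
  (forall g, symmetry (convex_hull X) g -> g z = z) ->
  adjacent (convex_hull X) x y -> x <> z -> y <> z ->
  ~ (forall g h, symmetry (convex_hull X) g -> symmetry (convex_hull X) h ->
      dot (g x - z) (h y - z) = 0).
Proof.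
move=> finX dimP trans fix_z xy xz yz orth.
have symid : symmetry (convex_hull X) id by split; [move=> ? ?|rewrite image_id].
have a0 : 0 < dot (x - z) (x - z) by rewrite dot_gt0 // subr_eq0; apply/eqP.
have b0 : 0 < dot (y - z) (y - z) by rewrite dot_gt0 // subr_eq0; apply/eqP.
have ab : dot (x - z) (y - z) = 0 by apply: (orth id id).
have orthx h (symh : symmetry (convex_hull X) h) := orth id h symid symh.
have lineY h : symmetry (convex_hull X) h -> exists k, h y - z = k *: (y - z).
  move=> symh; apply: (orthogonal_orbits_line finX dimP trans yz _ (adjacentC xy) symh).
  by move=> h1 h2 sym1 sym2; rewrite dotC orth.
have span w : dot w (x - z) = 0 -> dot w (y - z) = 0 -> w = 0.
  move=> wx wy; apply: (orthogonal_orbits_span finX dimP trans xz orthx xy wx).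
  by move=> h /lineY[k ->]; rewrite dotZr wy mulr0.
have [ex _] := adjacent_exposed finX xy.
have [y' xy' y'y] : exists2 y', adjacent (convex_hull X) x y' & y' <> y.
  apply: contrapT => no.
  (* the combination orthogonal to [y - x], but not to [x - z] *)
  pose u := dot (y - z) (y - z) *: (x - z) + dot (x - z) (x - z) *: (y - z).
  have u0 : u = 0.
    apply: (edges_span finX dimP ex) => y' xy'.
    have -> : y' = y by apply: contrapT => y'y; apply: no; exists y'.
    have -> : y - x = (y - z) - (x - z) by rewrite opprB addrA subrK.
    rewrite /u; move: (x - z) (y - z) ab => a b ab.
    rewrite dotDr dotNr !dotDl !dotZl (dotC b a) ab; ring.
  have : dot u (x - z) = 0 by rewrite u0 dot0l.
  rewrite dotDl !dotZl (dotC (y - z) (x - z)) ab mulr0 addr0 => /eqP.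
  by rewrite gt_eqF // mulr_gt0.
have [g Gg [xg yg]] := orthogonal_orbits_neighbour trans xz orthx xy xy'.
have symg := proper_symmetry Gg; have gz := fix_z _ symg.
have aA := symmetryB x symg gz; have bA := symmetryB y symg gz.
have [k ek] := lineY g symg.
have km1 : k = -1.
  have := symmetry_dot y y symg gz; rewrite ek dotZl dotZr mulrA => k2.
  have {}k2 : k * k = 1 by apply: (mulIf (lt0r_neq0 b0)); rewrite mul1r.
  have /eqP : (k - 1) * (k + 1) = 0 by lra.
  rewrite mulf_eq0 => /orP[|]; last by rewrite addr_eq0 => /eqP.
  rewrite subr_eq0 => /eqP k1; case: y'y; rewrite yg.
  by apply: (addIr (- z)); rewrite ek k1 scale1r.
have [_ detA _] := Gg; move: detA; rewrite /orientation_preserving.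
pose c := (2 / dot (y - z) (y - z)) *: (y - z)^T.
have -> : linear_part g = 1%:M - c *m (y - z).
  apply/row_matrixP => i; rewrite !rowE; move: (delta_mx 0 i) => v.
  pose al := dot v (x - z) / dot (x - z) (x - z).
  pose be := dot v (y - z) / dot (y - z) (y - z).
  have ev : v = al *: (x - z) + be *: (y - z).
    apply/eqP; rewrite -subr_eq0; apply/eqP; apply: span;
    rewrite dotDl dotNl dotDl !dotZl ?ab ?(dotC (y - z) (x - z)) ?ab.
      by rewrite mulr0 addr0 divfK ?gt_eqF // subrr.
    by rewrite mulr0 add0r divfK ?gt_eqF // subrr.
  have vc : v *m (c *m (y - z)) = (2 * be) *: (y - z).
    rewrite mulmxA; have -> : v *m c = (2 * be)%:M.
      rewrite [LHS]mx11_scalar -scalemxAr mxE -dotE /be; congr _%:M; ring.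
    by rewrite mul_scalar_mx.
  rewrite mulmxBr mulmx1 vc {1 2}ev mulmxDl -!scalemxAl -aA -bA ek km1 -xg.
  by apply/rowP => j; rewrite !mxE; ring.
rewrite det_sub_rank1 -scalemxAr mxE -dotE divfK ?gt_eqF //; lra.
Qed.

End Transitivity.

(** * Edge-transitive polytopes have a scalar edge tensor *)

Theorem mainTheorem1 (R : realType) (N M : nat) (X : set 'rV[R]_N)
    (S : {vspace 'rV[R]_N}) :
  finite_set X ->
  affine_dim (convex_hull X) N ->
  \dim S = M ->
  transitive_on_edges (proper_symmetries (convex_hull X)) (convex_hull X) ->
  sum_sq_proj_edges S (convex_hull X) =
    sum_sq_edges (convex_hull X) * (M%:R / N%:R).
Proof.
move=> finX dimP dimS trans.
suff [l TE] : exists l, edge_tensor (convex_hull X) = l%:M.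
  have [Q [trQ ->]] := sum_sq_proj_edgesE S finX.
  rewrite sum_sq_edgesE // TE mul_scalar_mx mxtraceZ trQ dimS mxtrace_scalar.
  have [N0|N0] := posnP N; last by rewrite -mulr_natr; field; rewrite pnatr_eq0 -lt0n.
  have -> : M = 0%N.
    apply/eqP; rewrite -leqn0 -dimS.
    by apply: leq_trans (dimvS (subvf S)) _; rewrite dimvf /dim /= mul1n N0.
  by rewrite mul0r !mulr0.
have symT := edge_tensor_trmx finX.
have commT := fun g => @edge_tensor_comm _ _ X g finX.
move: symT commT; set T := edge_tensor _ => symT commT.
have [E0|/set0P[F0 eF0]] := eqVneq (edges (convex_hull X)) set0.
  by exists 0; rewrite /T /edge_tensor E0 fsbig_set0 raddf0.
have [z fix_z] := symmetry_fixpoint finX (ex_intro _ F0 eF0).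
have [x [y [xny eF _ _]]] := edge_segment finX eF0.
have xy : adjacent (convex_hull X) x y by split; rewrite -?eF.
have yx := adjacentC xy.
have [l xl] := endpoint_eigenvector finX dimP trans fix_z symT commT xy.
have [m ym] := endpoint_eigenvector finX dimP trans fix_z symT commT yx.
have scalar k : (x - z) *m T = k *: (x - z) -> (y - z) *m T = k *: (y - z) ->
    exists l, T = l%:M.
  by move=> xk yk; exists k; apply: (scalar_tensor finX dimP trans fix_z symT commT xy).
(* if [x = z], then [x - z = 0] is an eigenvector for any eigenvalue *)
have [xz|/eqP xz] := eqVneq x z.
  by apply: (scalar m) => //; rewrite xz subrr mul0mx scaler0.
have [yz|/eqP yz] := eqVneq y z.
  by apply: (scalar l) => //; rewrite yz subrr mul0mx scaler0.
have [lm|lm] := eqVneq l m; first by apply: (scalar l); rewrite // lm.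
exfalso; apply: (no_orthogonal_orbits finX dimP trans fix_z xy xz yz) => g h symg symh.
have xgl := symmetry_eigenvector symg (fix_z _ symg) (commT _ symg) xl.
have yhm := symmetry_eigenvector symh (fix_z _ symh) (commT _ symh) ym.
(* eigenvectors of a symmetric matrix for distinct eigenvalues *)
have := dot_mulmx (g x - z) (h y - z) T.
rewrite symT xgl yhm dotZl dotZr => /eqP.
by rewrite -subr_eq0 -mulrBl mulf_eq0 subr_eq0 (negPf lm) => /eqP.
Qed.
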